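(* Let $p>0$ and $t>0$, let $\mathcal{S}_p=\{x^{-p}e^{ix} : 1<x<\infty\}\subset\mathbb{C}$, and define $g_t:(0,1)\to\mathcal{S}_p$ by $g_t(x)=x^{tp}\exp(i/x^t)$. Put $$\alpha=\min\left\{\frac{tp}{t+1},1\right\},\qquad \beta=\max\{tp,1\}.$$ Then $g_t$ is an $(\alpha,\beta)$-Hölder homeomorphism between $(0,1)$ and $\mathcal{S}_p$, and these Hölder exponents are sharp; that is, $g_t$ is not $\alpha'$-Hölder for any $\alpha'\in(\alpha,1]$, and $g_t^{-1}:\mathcal{S}_p\to(0,1)$ is not $(1/\beta')$-Hölder for any $\beta'\in[1,\beta)$.
   Context: For $X\subset\mathbb{C}$ and $\alpha\in(0,1]$, a function $f:X\to\mathbb{C}$ is $\alpha$-Hölder if there is a constant $C>0$ such that $|f(x)-f(y)|\leq C|x-y|^\alpha$ for all $x,y\in X$. For $0<\alpha\leq1\leq\beta<\infty$, a homeomorphism $f:X\to Y$ between subsets of $\mathbb{C}$ is $(\alpha,\beta)$-Hölder if there is a constant $C>0$ such that $C^{-1}|x-y|^\beta\leq|f(x)-f(y)|\leq C|x-y|^\alpha$ for all $x,y\in X$; equivalently $f$ is $\alpha$-Hölder and $f^{-1}$ is $\beta^{-1}$-Hölder. *)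

(* Defs.v *)
From Stdlib Require Import Reals.
From Coquelicot Require Import Coquelicot.
Open Scope R_scope.

(* A function between subsets X, Y of C is a total function C -> C of which
   only the restriction to X is ever used. *)

(* [Rpower 0 a] is 1 in Stdlib; here 0^a = 0.  Meant for d >= 0 and a > 0. *)
Definition rpow (d a : R) : R :=
  if Req_EM_T d 0 then 0 else Rpower d a.

Definition holder (a : R) (X : C -> Prop) (f : C -> C) : Prop :=
  exists K : R, 0 < K /\
    forall x y : C, X x -> X y ->
      Cmod (f x - f y)%C <= K * rpow (Cmod (x - y)%C) a.

(* h restricted to Y is the two-sided inverse of the map f : X -> Y; its values
   on Y are then uniquely determined. *)
Definition inverse_on (X Y : C -> Prop) (f h : C -> C) : Prop :=
  (forall x : C, X x -> Y (f x) /\ h (f x) = x) /\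
  (forall y : C, Y y -> X (h y) /\ f (h y) = y).

Definition homeomorphism (X Y : C -> Prop) (f : C -> C) : Prop :=
  exists h : C -> C,
    inverse_on X Y f h /\ continuous_on X f /\ continuous_on Y h.

Definition holder_homeomorphism
    (a b : R) (X Y : C -> Prop) (f : C -> C) : Prop :=
  0 < a <= 1 /\ 1 <= b /\ homeomorphism X Y f /\
  exists K : R, 0 < K /\
    forall x y : C, X x -> X y ->
      / K * rpow (Cmod (x - y)%C) b <= Cmod (f x - f y)%C /\
      Cmod (f x - f y)%C <= K * rpow (Cmod (x - y)%C) a.

(* e^{i theta} *)
Definition cis (theta : R) : C := (cos theta, sin theta).

(* The interval (0,1) as a subset of C. *)
Definition unit_interval (z : C) : Prop :=
  exists x : R, 0 < x < 1 /\ z = RtoC x.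

Definition spiral (p : R) (z : C) : Prop :=
  exists x : R, 1 < x /\ z = (RtoC (Rpower x (- p)) * cis x)%C.

(* On the real interval (0,1), [fst z] is z itself. *)
Definition g (p t : R) (z : C) : C :=
  let x := fst z in
  (RtoC (Rpower x (t * p)) * cis (1 / Rpower x t))%C.

(* Main.v *)
(** Write [g x - g y = x^{tp} (e^{i x^{-t}} - e^{i y^{-t}}) + (x^{tp} - y^{tp}) e^{i y^{-t}}]
    for [x < y].  The second term is bounded by a multiple of
    [|x - y|^{min(tp, 1)}].  The first is at most
    [x^{tp} min(2, t x^{-t-1} |x - y|)], and [min(2, u) <= 2 u^alpha] together
    with [(t + 1) alpha <= t p] turns this into a multiple of [|x - y|^alpha].
    The lower bound already holds for the moduli: [y^{tp} - x^{tp}] dominates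
    [(y - x)^{tp}] when [tp >= 1] and [tp (y - x)] otherwise.

    The exponent [alpha] is sharp on pairs of points half a turn apart, with
    phases [2 pi n] and [2 pi n + pi]; [beta] is sharp on the pairs [y/2, y]
    with [y -> 0]. *)

Require Import Defs.
From Stdlib Require Import Reals Lra.
From Coquelicot Require Import Coquelicot.
Open Scope R_scope.

(** * Monotonicity, increments and growth of real powers *)

Lemma Rpower_pos (x a : R) : 0 < Rpower x a.
Proof. apply exp_pos. Qed.

Lemma Rpower_base_1 (a : R) : Rpower 1 a = 1.
Proof. unfold Rpower. rewrite ln_1, Rmult_0_r. apply exp_0. Qed.

Lemma Rpower_le_exp_anti (x a b : R) :
  0 < x <= 1 -> a <= b -> Rpower x b <= Rpower x a.
Proof.
intros Hx Hab. unfold Rpower.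
assert (Hl : ln x <= 0) by (rewrite <- ln_1; apply ln_le; lra).
destruct (Rle_lt_or_eq_dec (b * ln x) (a * ln x)) as [H|H]; [nra| |].
- left. now apply exp_increasing.
- rewrite H. apply Rle_refl.
Qed.

Lemma Rpower_le_base_anti (x y a : R) :
  0 < x <= y -> a <= 0 -> Rpower y a <= Rpower x a.
Proof.
intros Hxy Ha. unfold Rpower.
assert (Hl : ln x <= ln y) by (apply ln_le; lra).
destruct (Rle_lt_or_eq_dec (a * ln y) (a * ln x)) as [H|H]; [nra| |].
- left. now apply exp_increasing.
- rewrite H. apply Rle_refl.
Qed.

Lemma Rpower_le_1 (x a : R) : 0 < x <= 1 -> 0 <= a -> Rpower x a <= 1.
Proof.
intros Hx Ha. rewrite <- (Rpower_O x) by lra. now apply Rpower_le_exp_anti.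
Qed.

Lemma Rpower_mult_pred (x a : R) : 0 < x -> x * Rpower x (a - 1) = Rpower x a.
Proof.
intros Hx. rewrite <- (Rpower_1 x) at 1 by lra.
rewrite <- Rpower_plus. f_equal; ring.
Qed.

(** Write [z^a = z * z^(a-1)]. As [z^(a-1)] is nondecreasing, the factors at [x] and [y - x] are at
    most the one at [y], and [x + (y - x) = y]. *)
Lemma Rpower_superadditive (x y a : R) : 1 <= a -> 0 < x < y ->
  Rpower (y - x) a <= Rpower y a - Rpower x a.
Proof.
intros Ha Hxy.
rewrite <- (Rpower_mult_pred (y - x)), <- (Rpower_mult_pred x),
  <- (Rpower_mult_pred y) by lra.
assert (H1 : Rpower x (a - 1) <= Rpower y (a - 1)) by (apply Rle_Rpower_l; lra).
assert (H2 : Rpower (y - x) (a - 1) <= Rpower y (a - 1))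
  by (apply Rle_Rpower_l; lra).
nra.
Qed.

(** The same factorisation, with [z^(a-1)] now nonincreasing. *)
Lemma Rpower_subadditive (x y a : R) : a <= 1 -> 0 < x < y ->
  Rpower y a - Rpower x a <= Rpower (y - x) a.
Proof.
intros Ha Hxy.
rewrite <- (Rpower_mult_pred (y - x)), <- (Rpower_mult_pred x),
  <- (Rpower_mult_pred y) by lra.
assert (H1 : Rpower y (a - 1) <= Rpower x (a - 1))
  by (apply Rpower_le_base_anti; lra).
assert (H2 : Rpower y (a - 1) <= Rpower (y - x) (a - 1))
  by (apply Rpower_le_base_anti; lra).
nra.
Qed.

Lemma Rpower_MVT (x y a : R) : 0 < x < y -> exists c : R, x < c < y /\
  Rpower y a - Rpower x a = a * Rpower c (a - 1) * (y - x).
Proof.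
intros Hxy.
destruct (MVT_cor2 (fun z => Rpower z a) (fun z => a * Rpower z (a - 1)) x y)
  as [c [Hc Hcxy]].
- lra.
- intros c Hc. apply derivable_pt_lim_power. lra.
- exists c. split; [exact Hcxy | exact Hc].
Qed.

(** Supplies the contradiction in both sharpness proofs, where a Hölder bound would keep some
    positive power of [s] bounded. The absolute value in the threshold keeps the base positive for
    every [M]. *)
Lemma Rpower_eventually_gt (a M : R) : 0 < a ->
  exists s0 : R, forall s : R, s0 < s -> M < Rpower s a.
Proof.
intros Ha. exists (Rpower (Rabs M + 1) (/ a)). intros s Hs.
assert (HM : 0 < Rabs M + 1) by (pose proof (Rabs_pos M); lra).
apply Rlt_trans with (Rabs M + 1); [pose proof (Rle_abs M); lra|].
rewrite <- (Rpower_1 (Rabs M + 1)) at 1 by lra.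
replace 1 with (/ a * a) at 2 by (field; lra).
rewrite <- Rpower_mult. apply Rlt_Rpower_l; [lra|].
split; [apply Rpower_pos | exact Hs].
Qed.

(** * Powers with the convention [0^a = 0] *)

Lemma rpow_0 (a : R) : rpow 0 a = 0.
Proof. unfold rpow. destruct (Req_EM_T 0 0); lra. Qed.

Lemma rpow_pos (d a : R) : 0 < d -> rpow d a = Rpower d a.
Proof. intros Hd. unfold rpow. destruct (Req_EM_T d 0); lra. Qed.

Lemma rpow_1 (d : R) : 0 <= d -> rpow d 1 = d.
Proof.
intros [Hd|<-]; [|apply rpow_0].
rewrite rpow_pos by exact Hd. now apply Rpower_1.
Qed.

Lemma rpow_ge_0 (d a : R) : 0 <= rpow d a.
Proof.
unfold rpow. destruct (Req_EM_T d 0); [lra|]. left. apply Rpower_pos.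
Qed.

Lemma rpow_le_compat (d e a : R) : 0 <= a -> 0 <= d <= e -> rpow d a <= rpow e a.
Proof.
intros Ha [[Hd|<-] He].
- rewrite !rpow_pos by lra. apply Rle_Rpower_l; lra.
- rewrite rpow_0. apply rpow_ge_0.
Qed.

Lemma rpow_lt_reg (d e a : R) : 0 < a -> 0 <= d -> 0 < e ->
  rpow d a < rpow e a -> d < e.
Proof.
intros Ha Hd He H. apply Rnot_le_lt. intros Hed.
apply (Rlt_not_le _ _ H). apply rpow_le_compat; lra.
Qed.

(** * Moduli, chords of the unit circle, and continuity from power bounds *)

Lemma Cmod_minus_sym (u v : C) : Cmod (u - v)%C = Cmod (v - u)%C.
Proof. rewrite <- Cmod_opp. apply (f_equal Cmod). ring. Qed.

Lemma Cmod_RtoC_minus (x y : R) : x <= y -> Cmod (RtoC x - RtoC y)%C = y - x.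
Proof.
intros H. rewrite <- RtoC_minus, Cmod_R, Rabs_minus_sym.
apply Rabs_pos_eq. lra.
Qed.

Lemma Cmod_cis (a : R) : Cmod (cis a) = 1.
Proof.
transitivity (sqrt 1); [|exact sqrt_1]. apply (f_equal sqrt). unfold cis; simpl.
pose proof (sin2_cos2 a) as H. unfold Rsqr in H. lra.
Qed.

Lemma Cmod_scal_cis (r a : R) : 0 <= r -> Cmod (RtoC r * cis a)%C = r.
Proof.
intros Hr. rewrite Cmod_mult, Cmod_cis, Cmod_R, Rabs_pos_eq by exact Hr. ring.
Qed.

Lemma Cmod_cis_minus_le_2 (a b : R) : Cmod (cis a - cis b)%C <= 2.
Proof.
unfold Cminus.
pose proof (Cmod_triangle (cis a) (- cis b)%C) as H.
rewrite Cmod_opp, !Cmod_cis in H. lra.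
Qed.

(** A chord is no longer than its arc: the squared chord is [2 - 2 cos (a - b) = 4 sin^2 ((a - b) /
    2)]. *)
Lemma Cmod_cis_minus_le (a b : R) : b < a -> Cmod (cis a - cis b)%C <= a - b.
Proof.
intros Hab.
rewrite <- (sqrt_Rsqr (a - b)) by lra.
unfold Cmod. apply sqrt_le_1_alt. simpl.
assert (Hc : cos (a - b) = 1 - 2 * sin ((a - b) / 2) * sin ((a - b) / 2)).
{ rewrite <- cos_2a_sin. f_equal. field. }
rewrite cos_minus in Hc.
assert (Hs : - ((a - b) / 2) <= sin ((a - b) / 2) <= (a - b) / 2).
{ split; [|left; apply sin_lt_x; lra].
  (* Up to [PI] the sine is nonnegative; beyond it, [sin >= -1] suffices because the half angle
     exceeds 1. *)
  destruct (Rle_lt_dec ((a - b) / 2) PI) as [H|H].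
  - pose proof (sin_ge_0 ((a - b) / 2)). lra.
  - pose proof (SIN_bound ((a - b) / 2)). pose proof PI2_1. lra. }
pose proof (sin2_cos2 a) as Ha. pose proof (sin2_cos2 b) as Hb.
unfold Rsqr in *. nra.
Qed.

(** Exponents on both sides let one lemma serve both directions: [b = 1] is the Hölder bound for
    [g], while [a = 1] is the lower bound for [g] read as a statement about its inverse. *)
Lemma continuous_on_of_rpow_bound (X : C -> Prop) (f : C -> C) (K a b : R) :
  0 < a -> 0 < b -> 0 < K ->
  (forall x y : C, X x -> X y ->
     rpow (Cmod (f x - f y)%C) b <= K * rpow (Cmod (x - y)%C) a) ->
  continuous_on X f.
Proof.
intros Ha Hb HK H x Hx.
apply filterlim_locally. intros eps.
pose proof (cond_pos eps) as Heps.
set (m := Rpower (eps : R) b / K).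
assert (Hm : 0 < m) by (apply Rdiv_lt_0_compat; [apply Rpower_pos | exact HK]).
(* Balls of [C] are products of balls in the coordinates; dividing by [sqrt 2] converts a
   coordinatewise bound into one on the modulus. *)
assert (Hd : 0 < Rpower m (/ a) / sqrt 2).
{ apply Rdiv_lt_0_compat; [apply Rpower_pos | apply sqrt_lt_R0; lra]. }
exists (mkposreal _ Hd). intros y [Hy1 Hy2] HyX.
assert (Hxy : Cmod (y - x)%C < Rpower m (/ a)).
{ apply Rle_lt_trans with (1 := Cmod_2Rmax _).
  assert (Hmax : Rmax (Rabs (fst (y - x)%C)) (Rabs (snd (y - x)%C))
                 < Rpower m (/ a) / sqrt 2)
    by (apply Rmax_lub_lt; [exact Hy1 | exact Hy2]).
  apply Rmult_lt_compat_l with (r := sqrt 2) in Hmax;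
    [|apply sqrt_lt_R0; lra].
  replace (sqrt 2 * (Rpower m (/ a) / sqrt 2)) with (Rpower m (/ a)) in Hmax.
  - exact Hmax.
  - field. apply Rgt_not_eq, sqrt_lt_R0; lra. }
assert (Hlt : rpow (Cmod (y - x)%C) a < m).
{ destruct (Cmod_ge_0 (y - x)%C) as [Hpos|<-]; [|rewrite rpow_0; exact Hm].
  rewrite rpow_pos by exact Hpos.
  rewrite <- (Rpower_1 m) by exact Hm.
  replace 1 with (/ a * a) by (field; lra).
  rewrite <- Rpower_mult. apply Rlt_Rpower_l; lra. }
assert (Hf : Cmod (f y - f x)%C < eps).
{ apply rpow_lt_reg with b; [exact Hb | apply Cmod_ge_0 | exact Heps |].
  rewrite (rpow_pos eps) by exact Heps.
  apply Rle_lt_trans with (1 := H y x HyX Hx).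
  replace (Rpower eps b) with (K * m) by (unfold m; field; lra).
  now apply Rmult_lt_compat_l. }
pose proof (Rmax_Cmod (f y - f x)%C) as HM.
split.
- apply Rle_lt_trans with (2 := Hf).
  apply Rle_trans with (2 := HM). exact (Rmax_l _ _).
- apply Rle_lt_trans with (2 := Hf).
  apply Rle_trans with (2 := HM). exact (Rmax_r _ _).
Qed.

(** * The spiral map and its inverse *)

Lemma g_RtoC (p t x : R) :
  g p t (RtoC x) = (RtoC (Rpower x (t * p)) * cis (Rpower x (- t)))%C.
Proof.
unfold g; simpl. rewrite Rpower_Ropp. do 3 f_equal. unfold Rdiv. ring.
Qed.

(** Reparametrises by the phase [s = x^(-t)], which is the parameter used in [spiral]. *)
Lemma g_at_phase (p t s : R) : 0 < t -> 0 < s ->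
  g p t (RtoC (Rpower s (- / t))) = (RtoC (Rpower s (- p)) * cis s)%C.
Proof.
intros Ht Hs. rewrite g_RtoC, !Rpower_mult.
replace (- / t * (t * p)) with (- p) by (field; lra).
replace (- / t * - t) with 1 by (field; lra).
now rewrite Rpower_1.
Qed.

Lemma Rpower_neg_inv_unit (s t : R) : 1 < s -> 0 < t -> 0 < Rpower s (- / t) < 1.
Proof.
intros Hs Ht. split; [apply Rpower_pos|].
rewrite <- (Rpower_O s) by lra. apply Rpower_lt; [exact Hs|].
pose proof (Rinv_0_lt_compat t Ht). lra.
Qed.

Lemma Rpower_gt_1 (x t : R) : 0 < x < 1 -> 0 < t -> 1 < Rpower x (- t).
Proof.
intros Hx Ht. rewrite <- exp_0. unfold Rpower. apply exp_increasing.
assert (ln x < 0) by (rewrite <- ln_1; apply ln_increasing; lra). nra.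
Qed.

(** The modulus of [g p t x] is [x^(tp)], strictly increasing in [x], so the modulus alone recovers
    [x]. *)
Definition spiral_inv (p t : R) (z : C) : C :=
  RtoC (Rpower (Cmod z) (/ (t * p))).

Lemma Cmod_g (p t x : R) : Cmod (g p t (RtoC x)) = Rpower x (t * p).
Proof. rewrite g_RtoC. apply Cmod_scal_cis. left. apply Rpower_pos. Qed.

Lemma inverse_on_spiral_inv (p t : R) : 0 < p -> 0 < t ->
  inverse_on unit_interval (spiral p) (g p t) (spiral_inv p t).
Proof.
intros Hp Ht. assert (Htp : 0 < t * p) by nra. split.
- intros z [x [Hx ->]]. split.
  + exists (Rpower x (- t)). split; [now apply Rpower_gt_1|].
    rewrite g_RtoC, Rpower_mult. do 3 f_equal. ring.
  + unfold spiral_inv. rewrite Cmod_g, Rpower_mult.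
    rewrite Rinv_r by lra. rewrite Rpower_1; [reflexivity | lra].
- intros z [s [Hs ->]].
  assert (E : spiral_inv p t (RtoC (Rpower s (- p)) * cis s)%C
              = RtoC (Rpower s (- / t))).
  { unfold spiral_inv.
    rewrite Cmod_scal_cis by (left; apply Rpower_pos).
    rewrite Rpower_mult. do 2 f_equal. field. lra. }
  rewrite E. split.
  + exists (Rpower s (- / t)). split; [now apply Rpower_neg_inv_unit | reflexivity].
  + apply g_at_phase; lra.
Qed.

(** * Two-sided Hölder estimates *)

Lemma Rpower_sub_upper (q a x y : R) : 0 < a -> a <= q -> a <= 1 ->
  0 < x < y -> y < 1 ->
  Rpower y q - Rpower x q <= (q + 1) * Rpower (y - x) a.
Proof.
intros Ha0 Haq Ha1 Hxy Hy.
pose proof (Rpower_pos (y - x) a) as Hpos.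
(* Subadditivity gives constant 1 for [q <= 1], and the derivative bound gives [q] for [q > 1];
   [q + 1] covers both. Since [y - x < 1], lowering the exponent to [a] only enlarges the right
   side. *)
destruct (Rle_lt_dec q 1) as [Hq|Hq].
- pose proof (Rpower_subadditive x y q Hq Hxy).
  pose proof (Rpower_le_exp_anti (y - x) a q). nra.
- destruct (Rpower_MVT x y q Hxy) as [c [Hc ->]].
  assert (H1 : Rpower c (q - 1) <= 1) by (apply Rpower_le_1; lra).
  assert (H2 : y - x <= Rpower (y - x) a).
  { rewrite <- (Rpower_1 (y - x)) at 1 by lra. apply Rpower_le_exp_anti; lra. }
  assert (H3 : q * Rpower c (q - 1) <= q) by nra.
  nra.
Qed.

Lemma Rpower_sub_lower (q x y : R) : 0 < q -> 0 < x < y -> y < 1 ->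
  Rpower (y - x) (Rmax q 1) <= (1 + / q) * (Rpower y q - Rpower x q).
Proof.
intros Hq Hxy Hy.
pose proof (Rinv_0_lt_compat q Hq) as Hqi.
(* For [q <= 1] the derivative on (0,1) is at least [q], giving constant [/ q]; for [q > 1]
   superadditivity gives 1. *)
destruct (Rle_lt_dec q 1) as [H|H].
- rewrite Rmax_right, Rpower_1 by lra.
  destruct (Rpower_MVT x y q Hxy) as [c [Hc ->]].
  assert (H1 : 1 <= Rpower c (q - 1)).
  { rewrite <- (Rpower_O c) at 1 by lra. apply Rpower_le_exp_anti; lra. }
  replace ((1 + / q) * (q * Rpower c (q - 1) * (y - x)))
    with ((1 + q) * (Rpower c (q - 1) * (y - x))) by (field; lra).
  assert (y - x <= Rpower c (q - 1) * (y - x)) by nra. nra.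
- rewrite Rmax_left by lra.
  assert (H1 : Rpower (y - x) q <= Rpower y q - Rpower x q)
    by (apply Rpower_superadditive; lra).
  pose proof (Rpower_pos (y - x) q). nra.
Qed.

Lemma phase_term_upper (p t a x y : R) : 0 < t -> 0 < a <= 1 ->
  (t + 1) * a <= t * p -> 0 < x < y -> y < 1 ->
  Rpower x (t * p) * Cmod (cis (Rpower x (- t)) - cis (Rpower y (- t)))%C
    <= 2 * Rpower t a * Rpower (y - x) a.
Proof.
intros Ht Ha Hap Hxy Hy.
(* The derivative of [z^(-t)] is largest in size at the left endpoint [x], so [u] bounds the phase
   difference. *)
set (u := t * Rpower x (- t - 1) * (y - x)).
assert (Hu : 0 < u).
{ pose proof (Rpower_pos x (- t - 1)).
  apply Rmult_lt_0_compat; [apply Rmult_lt_0_compat|]; lra. }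
assert (Hphase : 0 < Rpower x (- t) - Rpower y (- t) <= u).
{ destruct (Rpower_MVT x y (- t) Hxy) as [c [Hc E]].
  replace (Rpower x (- t) - Rpower y (- t))
    with (t * (Rpower c (- t - 1) * (y - x))) by lra.
  pose proof (Rpower_pos c (- t - 1)).
  assert (Rpower c (- t - 1) <= Rpower x (- t - 1))
    by (apply Rpower_le_base_anti; lra).
  split.
  - repeat apply Rmult_lt_0_compat; lra.
  - unfold u. rewrite Rmult_assoc. apply Rmult_le_compat_l; [lra|].
    apply Rmult_le_compat_r; lra. }
assert (Hmin : Cmod (cis (Rpower x (- t)) - cis (Rpower y (- t)))%C
               <= 2 * Rpower u a).
{ pose proof (Rpower_pos u a).
  destruct (Rle_lt_dec u 1) as [H1|H1].
  - apply Rle_trans with (Rpower x (- t) - Rpower y (- t)).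
    + apply Cmod_cis_minus_le. lra.
    + assert (u <= Rpower u a); [|lra].
      rewrite <- (Rpower_1 u) at 1 by lra. apply Rpower_le_exp_anti; lra.
  - pose proof (Cmod_cis_minus_le_2 (Rpower x (- t)) (Rpower y (- t))).
    assert (1 <= Rpower u a); [|lra].
    rewrite <- (Rpower_base_1 a). apply Rle_Rpower_l; lra. }
apply Rle_trans with (Rpower x (t * p) * (2 * Rpower u a)).
{ apply Rmult_le_compat_l; [left; apply Rpower_pos | exact Hmin]. }
unfold u.
pose proof (Rpower_pos x (- t - 1)) as Hx1.
rewrite <- (Rpower_mult_distr (t * Rpower x (- t - 1))), <- Rpower_mult_distr,
  Rpower_mult by (try apply Rmult_lt_0_compat; lra).
(* The powers of [x] combine to exponent [t p - (t + 1) a], nonnegative by hypothesis, so this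
   factor is at most 1. *)
replace (Rpower x (t * p)
         * (2 * (Rpower t a * Rpower x ((- t - 1) * a) * Rpower (y - x) a)))
  with (Rpower x (t * p + (- t - 1) * a)
         * (2 * Rpower t a * Rpower (y - x) a)) by (rewrite Rpower_plus; ring).
assert (H1 : Rpower x (t * p + (- t - 1) * a) <= 1) by (apply Rpower_le_1; lra).
pose proof (Rpower_pos t a). pose proof (Rpower_pos (y - x) a).
rewrite <- (Rmult_1_l (2 * Rpower t a * Rpower (y - x) a)) at 2.
apply Rmult_le_compat_r; [nra | exact H1].
Qed.

Lemma g_upper (p t a x y : R) : 0 < t -> 0 < a <= 1 ->
  (t + 1) * a <= t * p -> 0 < x < y -> y < 1 ->
  Cmod (g p t (RtoC x) - g p t (RtoC y))%C
    <= (t * p + 1 + 2 * Rpower t a) * Rpower (y - x) a.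
Proof.
intros Ht Ha Hap Hxy Hy. rewrite !g_RtoC.
set (X := Rpower x (t * p)). set (Y := Rpower y (t * p)).
set (u := cis (Rpower x (- t))). set (v := cis (Rpower y (- t))).
replace (RtoC X * u - RtoC Y * v)%C
  with (RtoC X * (u - v) + (RtoC X - RtoC Y) * v)%C by ring.
apply Rle_trans with (1 := Cmod_triangle _ _).
assert (Haq : a <= t * p) by nra.
assert (HXY : X <= Y) by (apply Rle_Rpower_l; lra).
rewrite !Cmod_mult. unfold v at 2.
rewrite Cmod_cis, Cmod_RtoC_minus, Cmod_R, Rabs_pos_eq
  by (exact HXY || (left; apply Rpower_pos)).
pose proof (phase_term_upper p t a x y Ht Ha Hap Hxy Hy) as H1.
pose proof (Rpower_sub_upper (t * p) a x y ltac:(lra) Haq ltac:(lra) Hxy Hy) as H2.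
fold X Y in H2. fold X u v in H1. lra.
Qed.

(** By the reverse triangle inequality it suffices to compare moduli, where the phases disappear. *)
Lemma g_lower (p t x y : R) : 0 < t * p -> 0 < x < y -> y < 1 ->
  Rpower (y - x) (Rmax (t * p) 1)
    <= (1 + / (t * p)) * Cmod (g p t (RtoC x) - g p t (RtoC y))%C.
Proof.
intros Htp Hxy Hy.
apply Rle_trans with (1 := Rpower_sub_lower (t * p) x y Htp Hxy Hy).
pose proof (Rinv_0_lt_compat _ Htp).
apply Rmult_le_compat_l; [lra|].
rewrite Cmod_minus_sym.
pose proof (Cmod_triangle (g p t (RtoC y) - g p t (RtoC x))%C (g p t (RtoC x))) as H1.
replace (g p t (RtoC y) - g p t (RtoC x) + g p t (RtoC x))%C
  with (g p t (RtoC y)) in H1 by ring.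
rewrite !Cmod_g in H1. lra.
Qed.

Lemma g_bounds (p t a : R) : 0 < p -> 0 < t -> 0 < a <= 1 ->
  (t + 1) * a <= t * p ->
  exists K : R, 0 < K /\
    forall x y : C, unit_interval x -> unit_interval y ->
      / K * rpow (Cmod (x - y)%C) (Rmax (t * p) 1)
        <= Cmod (g p t x - g p t y)%C /\
      Cmod (g p t x - g p t y)%C <= K * rpow (Cmod (x - y)%C) a.
Proof.
intros Hp Ht Ha Hap.
assert (Htp : 0 < t * p) by nra.
pose proof (Rinv_0_lt_compat _ Htp) as Hi.
pose proof (Rpower_pos t a) as Hta.
set (K := (t * p + 1 + 2 * Rpower t a) + (1 + / (t * p))).
assert (HK : 0 < K) by (unfold K; lra).
assert (Hlt : forall x y : R, 0 < x < y -> y < 1 ->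
  / K * rpow (Cmod (RtoC x - RtoC y)%C) (Rmax (t * p) 1)
    <= Cmod (g p t (RtoC x) - g p t (RtoC y))%C /\
  Cmod (g p t (RtoC x) - g p t (RtoC y))%C
    <= K * rpow (Cmod (RtoC x - RtoC y)%C) a).
{ intros x y Hxy Hy.
  rewrite Cmod_RtoC_minus, !rpow_pos by lra. split.
  - apply Rmult_le_reg_l with K; [exact HK|].
    rewrite <- Rmult_assoc, Rinv_r, Rmult_1_l by lra.
    apply Rle_trans with (1 := g_lower p t x y Htp Hxy Hy).
    apply Rmult_le_compat_r; [apply Cmod_ge_0 | unfold K; lra].
  - apply Rle_trans with (1 := g_upper p t a x y Ht Ha Hap Hxy Hy).
    apply Rmult_le_compat_r; [left; apply Rpower_pos | unfold K; lra]. }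
exists K. split; [exact HK|].
intros _ _ [x [Hx ->]] [y [Hy ->]].
destruct (Rtotal_order x y) as [H|[<-|H]].
- apply Hlt; lra.
(* On the diagonal the lower bound relies on [0^b = 0]; the value 1 of [Rpower 0 b] would break
   it. *)
- replace (RtoC x - RtoC x)%C with (RtoC 0) by ring.
  replace (g p t (RtoC x) - g p t (RtoC x))%C with (RtoC 0) by ring.
  rewrite Cmod_0, !rpow_0. lra.
- rewrite (Cmod_minus_sym (RtoC x)), (Cmod_minus_sym (g p t (RtoC x))).
  apply Hlt; lra.
Qed.

Lemma g_homeomorphism (p t a : R) : 0 < p -> 0 < t -> 0 < a <= 1 ->
  (t + 1) * a <= t * p ->
  homeomorphism unit_interval (spiral p) (g p t).
Proof.
intros Hp Ht Ha Hap.
pose proof (inverse_on_spiral_inv p t Hp Ht) as Hinv.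
exists (spiral_inv p t). split; [exact Hinv|].
destruct (g_bounds p t a Hp Ht Ha Hap) as [K [HK H]].
split.
- apply continuous_on_of_rpow_bound with (K := K) (a := a) (b := 1); try lra.
  intros x y Hx Hy. rewrite rpow_1 by apply Cmod_ge_0. now apply H.
- apply continuous_on_of_rpow_bound
    with (K := K) (a := 1) (b := Rmax (t * p) 1); try lra.
  { apply Rlt_le_trans with (2 := Rmax_r _ _). lra. }
  intros x y Hx Hy.
  (* The lower bound for [g], taken at the preimages of [x] and [y], is the bound required of the
     inverse. *)
  destruct Hinv as [_ Hinv].
  destruct (Hinv x Hx) as [Hx1 Hx2]. destruct (Hinv y Hy) as [Hy1 Hy2].
  destruct (H _ _ Hx1 Hy1) as [H1 _]. rewrite Hx2, Hy2 in H1.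
  rewrite rpow_1 by apply Cmod_ge_0.
  apply Rmult_le_compat_l with (r := K) in H1; [|lra].
  rewrite <- Rmult_assoc, Rinv_r, Rmult_1_l in H1 by lra. exact H1.
Qed.

(** * Sharpness of the exponents *)

Lemma g_not_holder (p t a : R) : 0 < t -> 0 < a -> t * p < a * (t + 1) ->
  ~ holder a unit_interval (g p t).
Proof.
intros Ht Ha Hap [K [HK H]].
(* At phase [s] the images are at least [s^(-p)] apart and the points at most
   [(PI / t) s^(-(1/t + 1))], so an [a]-Hölder bound would force [s^e <= M]. *)
set (e := a * (/ t + 1) - p).
assert (He : 0 < e).
{ unfold e. apply Rmult_lt_reg_l with t; [exact Ht|].
  replace (t * (a * (/ t + 1) - p)) with (a * (t + 1) - t * p) by (field; lra).
  lra. }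
set (M := K * Rpower (PI / t) a).
destruct (Rpower_eventually_gt e M He) as [s0 Hs0].
destruct (INR_unbounded (Rmax s0 1)) as [n Hn].
pose proof (Rmax_l s0 1). pose proof (Rmax_r s0 1).
pose proof PI2_1 as HPI.
set (s := 2 * INR n * PI).
assert (Hs : INR n < s) by (unfold s; nra).
specialize (Hs0 s ltac:(lra)).
assert (Hit : 0 < / t) by (apply Rinv_0_lt_compat; exact Ht).
set (x := Rpower s (- / t)). set (y := Rpower (s + PI) (- / t)).
assert (Hx : unit_interval (RtoC x)).
{ exists x. split; [apply Rpower_neg_inv_unit; lra | reflexivity]. }
assert (Hy : unit_interval (RtoC y)).
{ exists y. split; [apply Rpower_neg_inv_unit; lra | reflexivity]. }
(* The cosines are 1 and -1, so the real parts have opposite signs and their gap is at least the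
   first one. *)
assert (Hlow : Rpower s (- p) <= Cmod (g p t (RtoC x) - g p t (RtoC y))%C).
{ unfold x, y. rewrite !g_at_phase by lra.
  apply Rle_trans with (2 := re_le_Cmod _).
  unfold Re; simpl. rewrite neg_cos.
  replace (cos s) with 1.
  - pose proof (Rpower_pos (s + PI) (- p)).
    apply Rle_trans with (2 := Rle_abs _). lra.
  - unfold s. rewrite <- (Rplus_0_l (2 * INR n * PI)), cos_period.
    symmetry. apply cos_0. }
assert (Hd : 0 < x - y <= PI / t * Rpower s (- (/ t + 1))).
{ destruct (Rpower_MVT s (s + PI) (- / t)) as [c [Hc E]]; [lra|].
  fold x y in E. replace (s + PI - s) with PI in E by ring.
  replace (- / t - 1) with (- (/ t + 1)) in E by ring.
  replace (x - y) with (PI / t * Rpower c (- (/ t + 1)))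
    by (unfold Rdiv; lra).
  assert (0 < PI / t) by (apply Rdiv_lt_0_compat; lra).
  split.
  - apply Rmult_lt_0_compat; [assumption | apply Rpower_pos].
  - apply Rmult_le_compat_l; [lra|]. apply Rpower_le_base_anti; lra. }
specialize (H _ _ Hx Hy).
rewrite (Cmod_minus_sym (RtoC x)), Cmod_RtoC_minus, rpow_pos in H by lra.
assert (Hup : Rpower (x - y) a <= Rpower (PI / t) a * Rpower s (- (/ t + 1) * a)).
{ rewrite <- Rpower_mult, Rpower_mult_distr;
    [|apply Rdiv_lt_0_compat; lra | apply Rpower_pos].
  apply Rle_Rpower_l; lra. }
assert (Hc : Rpower s (- p) <= M * Rpower s (- (/ t + 1) * a)).
{ unfold M. rewrite Rmult_assoc.
  apply Rle_trans with (1 := Hlow). apply Rle_trans with (1 := H).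
  apply Rmult_le_compat_l; lra. }
replace (- p) with (e + - (/ t + 1) * a) in Hc by (unfold e; ring).
rewrite Rpower_plus in Hc.
apply Rmult_le_reg_r in Hc; [lra | apply Rpower_pos].
Qed.

Lemma g_inverse_not_holder (p t b : R) (ginv : C -> C) : 0 < b -> b < t * p ->
  inverse_on unit_interval (spiral p) (g p t) ginv ->
  ~ holder (1 / b) (spiral p) ginv.
Proof.
intros Hb Hbtp [Hinv _] [K [HK H]].
(* The points [y / 2] and [y] have images at most [2 y^(tp)] apart, so the Hölder bound would give
   [y <= M y^(e + 1)]. In [M], the outer 2 clears the distance [y / 2]. *)
set (e := t * p / b - 1).
assert (He : 0 < e).
{ unfold e. apply Rmult_lt_reg_l with b; [exact Hb|].
  replace (b * (t * p / b - 1)) with (t * p - b) by (field; lra). lra. }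
set (M := 2 * (K * Rpower 2 (1 / b))).
destruct (Rpower_eventually_gt e M He) as [s0 Hs0].
set (s := Rmax s0 1 + 1).
pose proof (Rmax_l s0 1). pose proof (Rmax_r s0 1).
specialize (Hs0 s ltac:(unfold s; lra)).
assert (Hs : 1 < s) by (unfold s; lra).
set (y := Rpower s (- 1)).
assert (Hy : 0 < y < 1).
{ unfold y. replace (- 1) with (- / 1) by field.
  apply Rpower_neg_inv_unit; lra. }
assert (HyI : unit_interval (RtoC y)) by (exists y; auto).
assert (HxI : unit_interval (RtoC (y / 2))).
{ exists (y / 2). split; [lra | reflexivity]. }
destruct (Hinv _ HyI) as [Hy1 Hy2]. destruct (Hinv _ HxI) as [Hx1 Hx2].
specialize (H _ _ Hx1 Hy1). rewrite Hx2, Hy2, Cmod_RtoC_minus in H by lra.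
assert (Hib : 0 < 1 / b) by (apply Rdiv_lt_0_compat; lra).
assert (Hdiff : Cmod (g p t (RtoC (y / 2)) - g p t (RtoC y))%C
                <= 2 * Rpower y (t * p)).
{ unfold Cminus. apply Rle_trans with (1 := Cmod_triangle _ _).
  rewrite Cmod_opp, !Cmod_g.
  assert (Rpower (y / 2) (t * p) <= Rpower y (t * p))
    by (apply Rle_Rpower_l; lra).
  lra. }
assert (Hpos : 0 < 2 * Rpower y (t * p)).
{ pose proof (Rpower_pos y (t * p)). lra. }
assert (Hr : rpow (Cmod (g p t (RtoC (y / 2)) - g p t (RtoC y))%C) (1 / b)
             <= Rpower 2 (1 / b) * Rpower y (t * p / b)).
{ apply Rle_trans with (rpow (2 * Rpower y (t * p)) (1 / b)).
  - apply rpow_le_compat; [lra|]. split; [apply Cmod_ge_0 | exact Hdiff].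
  - rewrite rpow_pos by exact Hpos.
    rewrite <- Rpower_mult_distr, Rpower_mult by (lra || apply Rpower_pos).
    replace (t * p * (1 / b)) with (t * p / b) by (field; lra). apply Rle_refl. }
assert (Hc : y <= M * Rpower y (t * p / b)).
{ apply Rmult_le_compat_l with (r := K) in Hr; [|lra]. unfold M. nra. }
replace (t * p / b) with (e + 1) in Hc by (unfold e; ring).
rewrite Rpower_plus, Rpower_1 in Hc by lra.
(* As [y = 1 / s], the choice [M < s^e] means [M y^e < 1], against [1 <= M y^e]. *)
assert (Hye : Rpower y e * Rpower s e = 1).
{ unfold y. rewrite Rpower_mult, <- Rpower_plus.
  replace (- 1 * e + e) with 0 by ring. apply Rpower_O; lra. }
pose proof (Rpower_pos y e).
assert (1 <= M * Rpower y e).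
{ apply Rmult_le_reg_r with y; [lra|]. lra. }
nra.
Qed.

Theorem theorem2p3 :
  forall p t : R, 0 < p -> 0 < t ->
  let alpha := Rmin (t * p / (t + 1)) 1 in
  let beta := Rmax (t * p) 1 in
  holder_homeomorphism alpha beta unit_interval (spiral p) (g p t) /\
  (forall alpha' : R, alpha < alpha' <= 1 ->
     ~ holder alpha' unit_interval (g p t)) /\
  (forall ginv : C -> C, inverse_on unit_interval (spiral p) (g p t) ginv ->
     forall beta' : R, 1 <= beta' < beta ->
       ~ holder (1 / beta') (spiral p) ginv).
Proof.
intros p t Hp Ht alpha beta.
assert (Htp : 0 < t * p) by nra.
assert (Ha : 0 < alpha <= 1).
{ split; [|apply Rmin_r]. apply Rmin_glb_lt; [apply Rdiv_lt_0_compat|]; lra. }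
assert (Hmul : t * p = (t + 1) * (t * p / (t + 1))) by (field; lra).
split; [|split].
- split; [exact Ha|]. split; [apply Rmax_r|].
  assert (Hap : (t + 1) * alpha <= t * p).
  { rewrite Hmul. apply Rmult_le_compat_l; [lra | apply Rmin_l]. }
  split; [now apply g_homeomorphism with alpha | now apply g_bounds].
- intros a' Ha'. apply g_not_holder; [exact Ht | lra |].
  rewrite Hmul, (Rmult_comm a'). apply Rmult_lt_compat_l; [lra|].
  (* Because [alpha' <= 1], exceeding the minimum means exceeding [t p / (t + 1)]. *)
  apply Rnot_le_lt. intros Hle.
  assert (a' <= alpha) by (apply Rmin_glb; lra). lra.
- intros ginv Hinv b' Hb'. apply (g_inverse_not_holder p t); [lra | | exact Hinv].
  destruct (Rle_lt_dec (t * p) b') as [H|H]; [|exact H].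
  assert (beta <= b') by (apply Rmax_lub; lra). lra.
Qed.
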